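(* Let $k\geq 2$ and $s\geq 0$ be integers and $\phi$ an antimorphic involution over a fixed finite alphabet $\Sigma$. Given a word $w\in\Sigma^*$, whether $w$ contains a factor of the form $(x\phi(x))^{k/2}$ if $k$ is even, or $(x\phi(x))^{\lfloor k/2\rfloor}x$ if $k$ is odd, for some word $x$ with $|x|>s$, can be tested in $O(|w|^2/k)$ time.
   Context: A map $\phi:\Sigma^*\to\Sigma^*$ is an involution if $\phi(\phi(w))=w$ for all $w$, and an antimorphism if $\phi(uv)=\phi(v)\phi(u)$ for all $u,v$; an antimorphic involution is both. A factor of $w$ is a word of consecutive letters of $w$. Time is measured in the unit-cost model with constant-time operations on $O(\log|w|)$-bit integers. *)

(* Defs.v *)
From mathcomp Require Import all_boot.
Set Implicit Arguments.
Unset Strict Implicit.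
Unset Printing Implicit Defensive.

Section Words.

Variable A : finType.
Implicit Types (phi : seq A -> seq A) (u v w x : seq A).

Definition antimorphism phi := forall u v, phi (u ++ v) = phi v ++ phi u.

Definition antimorphic_involution phi := involutive phi /\ antimorphism phi.

Definition word_exp u m := flatten (nseq m u).

Definition phi_power phi k x :=
  word_exp (x ++ phi x) k./2 ++ (if odd k then x else [::]).

Definition has_phi_power phi k s w :=
  exists x : seq A, s < size x /\ infix (phi_power phi k x) w.

End Words.

(* A unit-cost random access machine: a program is a fixed finite list of     *)
(* instructions acting on registers (addressed by literals) and on a memory   *)
(* (addressed through registers). Jump targets are positions in the program.  *)
(* Every instruction, halting ones included, takes one unit of time.          *)

Inductive binop := Add | Sub | Mul | Div.

Definition eval_binop (o : binop) : nat -> nat -> nat :=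
  match o with Add => addn | Sub => subn | Mul => muln | Div => divn end.

(* The first register of Const, Op and Read is the destination; the first of  *)
(* Write holds the target address.                                            *)
Inductive instr :=
  | Const (r c : nat)
  | Op (o : binop) (r r1 r2 : nat)
  | Read (r a : nat)
  | Write (a r : nat)
  | Jump (l : nat)
  | JumpLt (r1 r2 l : nat)
  | Answer (b : bool).

Definition program := seq instr.

Inductive state :=
  | Running (pc : nat) (reg mem : nat -> nat)
  | Halted (b : bool)
  | Fault.

Definition update (f : nat -> nat) (i v : nat) : nat -> nat :=
  fun j => if j == i then v else f j.

Section Machine.

(* Strict upper bound on the integers the machine may write and on the memory *)
(* addresses it may use: exceeding it is a fault, there is no wraparound.     *)
Variable B : nat.

Definition write_reg pc (reg mem : nat -> nat) (r v : nat) : state :=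
  if v < B then Running pc.+1 (update reg r v) mem else Fault.

Definition exec (i : instr) pc (reg mem : nat -> nat) : state :=
  match i with
  | Const r c => write_reg pc reg mem r c
  | Op o r r1 r2 => write_reg pc reg mem r (eval_binop o (reg r1) (reg r2))
  | Read r a =>
      if reg a < B then write_reg pc reg mem r (mem (reg a)) else Fault
  | Write a r =>
      if (reg a < B) && (reg r < B)
      then Running pc.+1 reg (update mem (reg a) (reg r)) else Fault
  | Jump l => Running l reg mem
  | JumpLt r1 r2 l => Running (if reg r1 < reg r2 then l else pc.+1) reg mem
  | Answer b => Halted b
  end.

Definition step (P : program) (st : state) : state :=
  match st with
  | Running pc reg mem =>
      if onth P pc is Some i then exec i pc reg mem else Fault
  | _ => st
  end.

End Machine.

(* Registers 0, 1, 2 initially hold |w|, k and s; memory cell i < |w| holds   *)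
(* the i-th letter of w, coded by its rank in an enumeration of the alphabet; *)
(* everything else is 0.                                                      *)
Definition init_state (A : finType) (k s : nat) (w : seq A) : state :=
  Running 0 (nth 0 [:: size w; k; s])
    (nth 0 [seq nat_of_ord (enum_rank a) | a <- w]).

(* P started on (k, s, w) halts with answer b after at most t unit-cost       *)
(* steps. The bound (|w| + 2) ^ d says that the integers written by P have    *)
(* O(log |w|) bits; k and s, being arbitrary parameters, are not subject to   *)
(* it as long as they stay in their input registers.                          *)
Definition answers_within (A : finType) (P : program) (d k s : nat)
    (w : seq A) (t : nat) (b : bool) : Prop :=
  iter t (step ((size w + 2) ^ d) P) (init_state k s w) = Halted b.

(* Main.v *)
(* An antimorphic involution reverses a word and applies a fixed letter map.  *)
(* Hence w contains a phi-power of x of length p at position i iff, at each   *)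
(* centre c = i + p, i + 2p, ..., i + (k - 1)p, the block of length p after c *)
(* is the phi-image of the block of length p before c, i.e. c is a phi-       *)
(* palindromic centre of radius >= p. Since k * p <= |w|, only |w| / k        *)
(* lengths p matter. Each is handled in O(|w|) steps: the centres of radius   *)
(* >= p are those of radius >= p - 1 passing one more letter comparison, and  *)
(* a left-to-right scan counts the consecutive ones c, c - p, c - 2p, ...     *)

Require Import Defs.
From mathcomp Require Import all_boot zify.

Set Implicit Arguments.
Unset Strict Implicit.
Unset Printing Implicit Defensive.

(** A power with |x| = p amounts to a run of k - 1 centres of radius p, spaced p apart
    ([has_phi_powerP]), and a radius grows from p to p + 1 by one letter comparison ([centreS]). So
    the count at c for length p follows in constant time from the old cell at c and the new one at c
    - p ([run_body]). As only p <= |w| / k matters, the total is of order |w| (|w| / k), up to setup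
    ([search_correct]). The letter map is tested by one divisibility ([rel_divisibility_code]), so
    the alphabet enters the program only through constants. *)

(** * Antimorphic involutions as letter maps *)

Lemma antimorphism_nil (A : finType) (phi : seq A -> seq A) :
  antimorphism phi -> phi [::] = [::].
Proof.
move=> phiM; have /(congr1 size) := phiM [::] [::].
by rewrite size_cat; case: (phi [::]) => //= a u; lia.
Qed.

(** No letter is erased, since [phi] fixes the empty word and is injective; so [phi] never shortens
    a word, and neither does its inverse, which is [phi] itself. *)
Lemma size_antimorphic_involution (A : finType) (phi : seq A -> seq A) u :
  antimorphic_involution phi -> size (phi u) = size u.
Proof.
move=> [phiK phiM]; have phi0 := antimorphism_nil phiM.
have le_phi v : size v <= size (phi v).
  elim: v => //= a v IHv; rewrite -cat1s phiM size_cat.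
  case E: (phi [:: a]) => [|b x] /=; last by lia.
  by have := phiK [:: a]; rewrite E phi0.
by apply/eqP; rewrite eqn_leq le_phi -{2}(phiK u) le_phi.
Qed.

Lemma antimorphic_involution_cons (A : finType) (phi : seq A -> seq A) :
  antimorphic_involution phi ->
  exists f : A -> A, forall a u, phi (a :: u) = rcons (phi u) (f a).
Proof.
move=> hphi; exists (fun a => head a (phi [:: a])) => a u.
rewrite -cat1s (proj2 hphi) -cats1; congr (_ ++ _).
by have := size_antimorphic_involution [:: a] hphi; case: (phi _) => [|b []].
Qed.

(** Peeling off a block swaps x and [phi x]; inductions on the exponent then need no parity case. *)
Lemma phi_powerS (A : finType) (phi : seq A -> seq A) k x :
  involutive phi -> phi_power phi k.+1 x = x ++ phi_power phi k (phi x).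
Proof.
move=> phiK; rewrite /phi_power /word_exp phiK.
have shift y z m t : flatten (nseq m (y ++ z)) ++ y ++ t =
    y ++ flatten (nseq m (z ++ y)) ++ t.
  by elim: m => //= m IHm; rewrite -!catA IHm !catA.
rewrite -uphalfE uphalf_half /=; case: (odd k); rewrite /= add0n.
  by have := shift _ (phi x) x k./2 [::]; rewrite !cats0 -!catA => ->.
by have := shift _ x (phi x) k./2 [::]; rewrite !cats0.
Qed.

(** * Powers as runs of centres *)

Section Centres.

Variables (A : finType) (phi : seq A -> seq A) (w : seq A).
Hypothesis hphi : antimorphic_involution phi.

Definition centre p c :=
  [&& p <= c, c + p <= size w &
      take p (drop c w) == phi (take p (drop (c - p) w))].

(** Counting leftwards lets the run at c extend the one at c - p. Truncated subtraction is harmless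
    for p > 0, as 0 is then no centre. *)
Definition centre_run p c m := all (fun i => centre p (c - i * p)) (iota 0 m).

Lemma centre_runP p c m :
  reflect (forall i, i < m -> centre p (c - i * p)) (centre_run p c m).
Proof.
by apply: (iffP allP) => H i; move: (H i); rewrite mem_iota.
Qed.

Lemma centre_runS p c m :
  centre_run p c m.+1 = centre p c && centre_run p (c - p) m.
Proof.
rewrite /centre_run /= subn0 -[1]addn0 iotaDl all_map.
by congr (_ && _); apply: eq_all => i /=; rewrite mulSn subnDA.
Qed.

Lemma centre0 c : centre 0 c = (c <= size w).
Proof.
by rewrite /centre addn0 !take0 (antimorphism_nil (proj2 hphi)) eqxx andbT.
Qed.

(** Widening prepends a letter to the left block; [phi] sends it to the end, facing the letter
    appended on the right. *)
Lemma centreS (f : A -> A) p c x0 :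
  (forall a u, phi (a :: u) = rcons (phi u) (f a)) ->
  p < c -> c + p < size w ->
  centre p.+1 c = centre p c && (nth x0 w (c + p) == f (nth x0 w (c - p.+1))).
Proof.
move=> phi_cons ltpc ltcpn; rewrite /centre ltpc addnS ltcpn (ltnW ltpc) ltnW //=.
rewrite (take_nth x0) ?size_drop; last by lia.
rewrite nth_drop (drop_nth x0 (n := c - p.+1)); last by lia.
by rewrite /= phi_cons eqseq_rcons -subSn.
Qed.

(** Each block after the first is the [phi]-image of its predecessor, which says that the boundary
    between them is a centre. *)
Lemma prefix_phi_power k x st :
  0 < size x ->
  prefix (phi_power phi k.+1 x) (drop st w) =
  [&& st + k.+1 * size x <= size w, x == take (size x) (drop st w)
    & all (fun i => centre (size x) (st + i.+1 * size x)) (iota 0 k)].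
Proof.
have prefix_cat u v y : prefix (u ++ v) y =
    (u == take (size u) y) && prefix v (drop (size u) y).
  have [le_uy | lt_yu] := leqP (size u) (size y).
    by rewrite !prefixE size_cat takeD eqseq_cat ?size_takel // !(eq_sym (take _ _)).
  rewrite take_oversize 1?ltnW //; case: eqP => [uy | _] /=.
    by rewrite uy ltnn in lt_yu.
  by apply/negP => /size_prefix; rewrite size_cat; lia.
have powS := phi_powerS _ _ (proj1 hphi).
elim: k x st => [|k IHk] x st x_gt0; rewrite powS prefix_cat.
  rewrite (_ : phi_power phi 0 _ = [::]) // prefix0s /= !andbT mul1n.
  case: eqP => [/(congr1 size) | _]; last by rewrite andbF.
  by rewrite size_take size_drop /= andbT; case: ltnP => ? ?; symmetry; lia.
rewrite drop_drop [_ + st]addnC IHk size_antimorphic_involution // -addnA -mulSn.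
rewrite /= mul1n {2}/centre addnK leq_addl -addnA addnn -mul2n.
rewrite -[1]addn0 iotaDl all_map.
under [in RHS]eq_all => i /= do rewrite mulSn addnA.
under eq_all => i do rewrite mulSn.
case: (boolP (_ <= _)) => //= lew; case: eqP => // {1}->.
by rewrite [in RHS]eq_sym (leq_trans _ lew) ?leq_add2l ?leq_mul2r ?orbT.
Qed.

Lemma has_phi_powerP k s :
  1 < k ->
  has_phi_power phi k s w <->
  exists p j, [/\ s < p, j <= size w, k * p <= size w & centre_run p j k.-1].
Proof.
case: k => [|[|k]] // _; split=> [[x [lt_sx /infixP [u [v Ew]]]] | [p [j]]].
  have x_gt0 : 0 < size x by lia.
  have: prefix (phi_power phi k.+2 x) (drop (size u) w).
    by rewrite Ew drop_size_cat // prefix_prefix.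
  rewrite prefix_phi_power // => /and3P [lew _ /allP all_centre].
  exists (size x), (size u + k.+1 * size x); split=> //; try lia.
  apply/centre_runP => i lt_ik.
  have -> : size u + k.+1 * size x - i * size x = size u + (k - i).+1 * size x.
    rewrite -addnBA ?leq_mul2r 1?ltnW ?orbT //; congr (_ + _).
    by rewrite -mulnBl subSn.
  by apply: all_centre; rewrite mem_iota; lia.
case=> lt_sp lejw lew /centre_runP all_centre.
have p_gt0 : 0 < p by lia.
have := all_centre k (ltnSn k) => /and3P [le_pk _ _].
have [Ej lej]: j = (j - k.+1 * p) + k.+1 * p /\ j + p <= size w.
  have := all_centre 0 isT; rewrite /centre mul0n subn0 => /and3P [_ -> _].
  by rewrite mulSn in le_pk *; lia.
(* The exponent is k + 2 here: one block follows the last centre [j] and k + 1 precede it; [Ej]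
   rules out truncation. *)
set st := j - _ in Ej; have size_x: size (take p (drop st w)) = p.
  by rewrite size_takel // size_drop; lia.
exists (take p (drop st w)); rewrite size_x; split=> //.
have pre: prefix (phi_power phi k.+2 (take p (drop st w))) (drop st w).
  rewrite prefix_phi_power size_x // eqxx andTb; apply/andP; split; first by lia.
  apply/allP => i; rewrite mem_iota => /andP [_ lt_ik].
  have -> : st + i.+1 * p = j - (k - i) * p.
    by rewrite Ej -addnBA -?mulnBl ?leq_mul2r; [congr (_ + _ * _) | ]; lia.
  by apply: all_centre; lia.
have [t Et] := prefixP pre; apply/infixP; exists (take st w), t.
by rewrite -Et cat_take_drop.
Qed.

End Centres.

(** * Arithmetic coding of the letter map *)

(** A common divisor is coprime to n! and divides (j - i) n!, hence j - i, hence n! itself, so it is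
    1. *)
Lemma coprime_beta i j n : i < n -> j < n -> i != j ->
  coprime (i.+1 * n`!).+1 (j.+1 * n`!).+1.
Proof.
wlog lt_ij : i j / i < j => [IH lt_in lt_jn|].
  by rewrite neq_ltn => /orP [] ltij; [|rewrite coprime_sym]; apply: IH => //; lia.
move=> lt_in lt_jn _; set d := gcdn (i.+1 * n`!).+1 (j.+1 * n`!).+1.
have co_d : coprime d n`!.
  have /coprime_dvdl -> // : d %| (i.+1 * n`!).+1 by apply: dvdn_gcdl.
  by rewrite coprime_sym /coprime -(addn1 (_ * _)) gcdnMDl gcdn1.
have d_ji : d %| (j - i) * n`!.
  have -> : (j - i) * n`! = (j.+1 * n`!).+1 - (i.+1 * n`!).+1.
    by rewrite subSS -mulnBl subSS.
  by apply: dvdn_sub; [apply: dvdn_gcdr | apply: dvdn_gcdl].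
have : d %| n`!.
  rewrite Gauss_dvdl // in d_ji; apply: dvdn_trans d_ji _.
  by apply: dvdn_fact; lia.
by move/gcdn_idPl; rewrite (eqP co_d) => d1; rewrite /coprime -/d -d1.
Qed.

(* Goedel's beta-function trick: a finite relation becomes divisibility of a  *)
(* single constant by pairwise coprime numbers, so that straight-line         *)
(* arithmetic code can compare letters up to the letter map.                  *)
Lemma rel_divisibility_code n (R : rel nat) :
  exists M T, 0 < M /\ forall a b, a < n -> b < n ->
    ((a * n + b).+1 * M).+1 %| T = R a b.
Proof.
pose m e := (e.+1 * (n * n)`!).+1.
exists (n * n)`!, (\prod_(e < n * n | R (e %/ n) (e %% n)) m e).
split=> [|a b lt_an lt_bn]; first exact: fact_gt0.
have lt_e : a * n + b < n * n.
  apply: (@leq_trans (a.+1 * n)); first by rewrite mulSn addnC ltn_add2r.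
  by rewrite leq_mul2r lt_an orbT.
have Ra : R a b = R ((a * n + b) %/ n) ((a * n + b) %% n).
  by rewrite divnMDl ?modnMDl ?(divn_small lt_bn) ?modn_small ?addn0 //; lia.
rewrite Ra -/(m (a * n + b)); case: (boolP (R _ _)) => Re.
  by rewrite (bigD1 (Ordinal lt_e)) //= dvdn_mulr.
(* The modulus of an unrelated pair is coprime to every factor of the product, so dividing it would
   make the modulus 1. *)
apply/negP => m_dvd; suff /eqP: m (a * n + b) = 1.
  by rewrite eqSS muln_eq0 /= -leqn0 leqNgt fact_gt0.
have: coprime (m (a * n + b)) (\prod_(e < n * n | R (e %/ n) (e %% n)) m e).
  elim/big_rec: _ => [|e x Re_ IH]; first exact: coprimen1.
  rewrite coprimeMr IH andbT coprime_beta // neq_ltn.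
  by rewrite -neq_ltn; apply: contraNneq Re => ->.
by rewrite /coprime (gcdn_idPl m_dvd) => /eqP.
Qed.

(** * Symbolic execution with a time budget *)

Section Runs.

Variables (B : nat) (P : program).

(** An upper bound on time lets branches of different lengths share one budget. *)
Definition runs_within t st (Q : state -> Prop) :=
  exists2 t', t' <= t & Q (iter t' (step B P) st).

Lemma runs_within0 t st (Q : state -> Prop) : Q st -> runs_within t st Q.
Proof. by exists 0. Qed.

Lemma runs_within_step t st Q :
  runs_within t (step B P st) Q -> runs_within t.+1 st Q.
Proof. by case=> t' le_t't Qt'; exists t'.+1; rewrite ?iterSr. Qed.

Lemma runs_within_trans t1 t2 st (Q1 Q2 : state -> Prop) :
  runs_within t1 st Q1 -> (forall st', Q1 st' -> runs_within t2 st' Q2) ->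
  runs_within (t1 + t2) st Q2.
Proof.
case=> t lt_t1 Qt /(_ _ Qt) [t' lt_t2 Qt'].
by exists (t' + t); [rewrite addnC leq_add | rewrite iterD].
Qed.

Lemma runs_within_leq t1 t2 st Q :
  t1 <= t2 -> runs_within t1 st Q -> runs_within t2 st Q.
Proof. by move=> le_t12 [t le_t1 Qt]; exists t => //; apply: leq_trans le_t12. Qed.

Variables (t pc : nat) (reg mem : nat -> nat) (Q : state -> Prop).

Lemma run_const r c : onth P pc = Some (Const r c) -> c < B ->
  runs_within t (Running pc.+1 (update reg r c) mem) Q ->
  runs_within t.+1 (Running pc reg mem) Q.
Proof. by move=> E ltB ?; apply: runs_within_step; rewrite /= E /= /write_reg ltB. Qed.

Lemma run_op v o r r1 r2 : onth P pc = Some (Op o r r1 r2) ->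
  eval_binop o (reg r1) (reg r2) = v -> v < B ->
  runs_within t (Running pc.+1 (update reg r v) mem) Q ->
  runs_within t.+1 (Running pc reg mem) Q.
Proof.
by move=> E Ev ltB ?; apply: runs_within_step; rewrite /= E /= Ev /write_reg ltB.
Qed.

Lemma run_read a r ra : onth P pc = Some (Read r ra) ->
  reg ra = a -> a < B -> mem a < B ->
  runs_within t (Running pc.+1 (update reg r (mem a)) mem) Q ->
  runs_within t.+1 (Running pc reg mem) Q.
Proof.
by move=> E Ea ltB ltmB ?; apply: runs_within_step;
  rewrite /= E /= Ea ltB /write_reg ltmB.
Qed.

Lemma run_write a v ra r : onth P pc = Some (Write ra r) ->
  reg ra = a -> reg r = v -> a < B -> v < B ->
  runs_within t (Running pc.+1 reg (update mem a v)) Q ->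
  runs_within t.+1 (Running pc reg mem) Q.
Proof.
by move=> E Ea Ev lta ltv ?; apply: runs_within_step; rewrite /= E /= Ea Ev lta ltv.
Qed.

Lemma run_jump l : onth P pc = Some (Jump l) ->
  runs_within t (Running l reg mem) Q ->
  runs_within t.+1 (Running pc reg mem) Q.
Proof. by move=> E ?; apply: runs_within_step; rewrite /= E. Qed.

Lemma run_lt b r1 r2 l : onth P pc = Some (JumpLt r1 r2 l) ->
  (reg r1 < reg r2) = b ->
  runs_within t (Running (if b then l else pc.+1) reg mem) Q ->
  runs_within t.+1 (Running pc reg mem) Q.
Proof. by move=> E Eb ?; apply: runs_within_step; rewrite /= E /= Eb. Qed.

Lemma run_answer b : onth P pc = Some (Answer b) ->
  Q (Halted b) -> runs_within t.+1 (Running pc reg mem) Q.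
Proof.
by move=> E ?; apply: runs_within_step; rewrite /= E /=; apply: runs_within0.
Qed.

End Runs.

(* Register 3 holds |w| / k, 4 the current length p, 5 the current centre c;  *)
(* those from 10 on are scratch. Cell |w| + c holds the count of centre c     *)
(* plus one, so that 1 marks c as dead; the initial 0 stands for a centre of  *)
(* radius 0. Instructions 18-29 compare the letters c - p and c + p - 1;      *)
(* instruction 35 tests for k - 1 consecutive centres.                        *)
Definition search (N M T : nat) : program :=
  [:: (*  0 *) Const 6 1
    ; (*  1 *) Const 7 M
    ; (*  2 *) Const 8 T
    ; (*  3 *) Const 9 N
    ; (*  4 *) Op Div 3 0 1
    ; (*  5 *) JumpLt 4 3 7
    ; (*  6 *) Answer false
    ; (*  7 *) Op Add 4 4 6
    ; (*  8 *) Const 5 0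
    ; (*  9 *) JumpLt 0 5 5
    ; (* 10 *) Op Add 10 0 5
    ; (* 11 *) JumpLt 5 4 39
    ; (* 12 *) Op Add 11 5 4
    ; (* 13 *) JumpLt 0 11 39
    ; (* 14 *) Read 12 10
    ; (* 15 *) JumpLt 12 6 18
    ; (* 16 *) JumpLt 6 12 18
    ; (* 17 *) Jump 39
    ; (* 18 *) Op Defs.Sub 13 5 4
    ; (* 19 *) Op Defs.Sub 11 11 6
    ; (* 20 *) Read 14 13
    ; (* 21 *) Read 15 11
    ; (* 22 *) Op Mul 14 14 9
    ; (* 23 *) Op Add 14 14 15
    ; (* 24 *) Op Add 14 14 6
    ; (* 25 *) Op Mul 14 14 7
    ; (* 26 *) Op Add 14 14 6
    ; (* 27 *) Op Div 15 8 14
    ; (* 28 *) Op Mul 15 15 14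
    ; (* 29 *) JumpLt 15 8 39
    ; (* 30 *) Op Add 13 0 13
    ; (* 31 *) Read 12 13
    ; (* 32 *) Op Add 12 12 6
    ; (* 33 *) Write 10 12
    ; (* 34 *) Op Add 5 5 6
    ; (* 35 *) JumpLt 12 1 9
    ; (* 36 *) JumpLt 2 4 38
    ; (* 37 *) Jump 9
    ; (* 38 *) Answer true
    ; (* 39 *) Write 10 6
    ; (* 40 *) Op Add 5 5 6
    ; (* 41 *) Jump 9 ].

(** * Correctness and running time of the search *)

Section Search.

Variables (A : finType) (phi : seq A -> seq A) (w : seq A) (k s : nat).
Hypotheses (hphi : antimorphic_involution phi) (k_gt1 : 1 < k).

Local Notation n := (size w).
Local Notation centre := (centre phi w).
Local Notation centre_run := (centre_run phi w).

Variables (code : nat -> nat) (B N M T : nat).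
Let test i j := ((code i * N + code j).+1 * M).+1.
Hypothesis centre_test : forall p c, p < c -> c + p < n ->
  centre p.+1 c = centre p c && (test (c - p.+1) (c + p) %| T).
Hypotheses (M_gt0 : 0 < M) (ltnB : n.*2.+2 < B).
Hypotheses (ltNB : N < B) (ltMB : M < B) (ltTB : T < B).
Hypothesis code_ltB : forall i, i < n -> code i < B.
Hypothesis test_ltB : forall i j, i < n -> j < n -> test i j < B.

Local Notation runs := (runs_within B (search N M T)).

Definition regs p c (reg : nat -> nat) :=
  map reg (iota 0 10) = [:: n; k; s; n %/ k; p; c; 1; M; T; N].

Definition counts p c v := forall m, (m < v) = centre_run p c m.

(* The cells n + j with j < c hold the counts of the current length p; the    *)
(* others are left over from p.-1, where 1 means that j is not a centre.      *)
Definition tape p c (mem : nat -> nat) :=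
  [/\ forall i, i < n -> mem i = code i,
      forall j, j < c -> counts p j (mem (n + j))
    & forall j, c <= j <= n ->
        mem (n + j) <= n.+1 /\ (mem (n + j) == 1) = ~~ centre p.-1 j].

(** Pairs are ordered lexicographically, as the search visits them. *)
Definition unfound p c := forall p' j, s < p' -> j <= n ->
  (p' < p) || (p' == p) && (j < c) -> ~~ centre_run p' j k.-1.

Definition correct_answer st :=
  exists2 b, st = Halted b & (b <-> has_phi_power phi k s w).

Definition next p c st := exists reg mem,
  [/\ st = Running 9 reg mem, regs p c.+1 reg, tape p c.+1 mem & unfound p c.+1].

(** A run of c + 1 centres would include position 0, which has no positive radius. This keeps the
    cells below the integer bound. *)
Lemma counts_leq p c v : 0 < p -> counts p c v -> v <= c.+1.
Proof.
move=> p_gt0 /(_ c.+1); case: leqP => // _ /esym /centre_runP /(_ c (ltnSn c)).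
have /eqP -> : c - c * p == 0 by rewrite subn_eq0 leq_pmulr.
by rewrite /centre leqNgt p_gt0.
Qed.

Lemma counts_dead p c : ~~ centre p c -> counts p c 1.
Proof. by move=> /negbTE dead [|m] //; rewrite centre_runS dead. Qed.

Lemma counts_centre p c v : centre p c -> counts p (c - p) v -> counts p c v.+1.
Proof. by move=> c_p cnt [|m] //; rewrite ltnS cnt centre_runS c_p. Qed.

Lemma tape_update p c mem v : c <= n -> counts p c v -> tape p c mem ->
  tape p c.+1 (update mem (n + c) v).
Proof.
move=> le_cn cnt [mem_code mem_cnt mem_old]; rewrite /update; split=> [i lt_in|j|j].
- by rewrite ifN ?mem_code //; lia.
- by rewrite ltnS leq_eqVlt eqn_add2l; case: eqP => [-> //|_ /=]; apply: mem_cnt.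
- move=> /andP [lt_cj le_jn]; rewrite eqn_add2l gtn_eqF //.
  by apply: mem_old; rewrite ltnW.
Qed.

(** As v is the longest run plus one, v < k excludes a run of k - 1 centres; for p <= s nothing is
    to be excluded. *)
Lemma unfound_next p c v : counts p c v -> unfound p c ->
  (v < k) || (p <= s) -> unfound p c.+1.
Proof.
move=> cnt none small p' j lt_sp' le_jn.
rewrite ltnS (leq_eqVlt j) andb_orr orbCA.
case/orP=> [/andP [/eqP Ep /eqP ->]|]; last exact: none.
by rewrite Ep -cnt -leqNgt -ltnS; move: k_gt1 lt_sp' small; lia.
Qed.

Lemma run_dead p c reg mem : c <= n -> ~~ centre p c ->
  regs p c reg -> reg 10 = n + c -> tape p c mem -> unfound p c ->
  runs 3 (Running 39 reg mem) (next p c).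
Proof.
move=> le_cn dead [r0 r1 r2 r3 r4 r5 r6 r7 r8 r9] r10 tp none.
apply: (run_write (a := n + c) (v := 1)); try (exact: erefl || exact: r10); try lia.
apply: (run_op (v := c.+1)); first exact: erefl.
- by rewrite /= r5 r6 addn1.
- by lia.
apply: run_jump; first exact: erefl.
apply: runs_within0; exists (update reg 5 c.+1), (update mem (n + c) 1); split=> //.
- by rewrite /regs /update /= r0 r1 r2 r3 r4 r6 r7 r8 r9.
- by apply: tape_update => //; apply: counts_dead.
- by apply: unfound_next (counts_dead dead) none _; rewrite k_gt1.
Qed.

Lemma run_centre p c reg mem : 0 < p -> k * p <= n -> c <= n -> centre p c ->
  regs p c reg -> reg 10 = n + c -> reg 13 = c - p -> tape p c mem -> unfound p c ->
  runs 9 (Running 30 reg mem) (fun st => correct_answer st \/ next p c st).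
Proof.
move=> p_gt0 lekpn le_cn cp [r0 r1 r2 r3 r4 r5 r6 r7 r8 r9] r10 r13 tp none.
have le_pc : p <= c by case/and3P: cp.
have cnt : counts p (c - p) (mem (n + (c - p))).
  by case: tp => _ mem_cnt _; apply: mem_cnt; lia.
set v := mem _ in cnt; have le_v := counts_leq p_gt0 cnt.
have cntc := counts_centre cp cnt.
apply: (run_op (v := n + (c - p))); first exact: erefl.
- by rewrite /= r0 r13.
- by lia.
apply: (run_read (a := n + (c - p))); try exact: erefl; rewrite -/v; try lia.
apply: (run_op (v := v.+1)); first exact: erefl.
- by rewrite /update /= r6 addn1.
- by lia.
apply: (run_write (a := n + c) (v := v.+1)); try exact: erefl; try lia.
  by rewrite /update /=.
apply: (run_op (v := c.+1)); first exact: erefl.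
- by rewrite /update /= r5 r6 addn1.
- by lia.
set reg' := update _ 5 _; set mem' := update _ (n + c) _.
have next_c : (v.+1 < k) || (p <= s) -> next p c (Running 9 reg' mem').
  move=> small; exists reg', mem'; split=> //.
  - by rewrite /regs /reg' /update /= r0 r1 r2 r3 r4 r6 r7 r8 r9.
  - exact: tape_update.
  - exact: unfound_next small.
apply: (run_lt (b := v.+1 < k)); first exact: erefl.
  by rewrite /reg' /update /= r1.
case: ltnP => [lt_vk | le_kv].
  by apply: runs_within0; right; apply: next_c; rewrite lt_vk.
apply: (run_lt (b := s < p)); first exact: erefl.
  by rewrite /reg' /update /= r2 r4.
case: ltnP => [lt_sp | le_ps]; last first.
  apply: run_jump; first exact: erefl.
  by apply: runs_within0; right; apply: next_c; rewrite le_ps orbT.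
apply: run_answer; first exact: erefl.
left; exists true => //; split=> // _; apply/has_phi_powerP => //.
by exists p, c; split=> //; rewrite -cntc; lia.
Qed.

Lemma run_body p c reg mem : 0 < p -> k * p <= n -> c <= n ->
  regs p c reg -> tape p c mem -> unfound p c ->
  runs 30 (Running 9 reg mem) (fun st => correct_answer st \/ next p c st).
Proof.
move=> p_gt0 lekpn le_cn [r0 r1 r2 r3 r4 r5 r6 r7 r8 r9] tp none.
have le_pn : p <= n by apply: leq_trans lekpn; rewrite leq_pmull // ltnW.
apply: (run_lt (b := false)); first exact: erefl.
  by rewrite r0 r5 ltnNge le_cn.
apply: (run_op (v := n + c)); first exact: erefl.
- by rewrite /= r0 r5.
- by lia.
have dead reg' : ~~ centre p c -> regs p c reg' -> reg' 10 = n + c ->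
    runs 3 (Running 39 reg' mem) (fun st => correct_answer st \/ next p c st).
  move=> cp hreg' r10; rewrite -[3]addn0.
  by apply: runs_within_trans (run_dead le_cn cp hreg' r10 tp none) _ => st ?;
    apply: runs_within0; right.
apply: (run_lt (b := c < p)); first exact: erefl.
  by rewrite /update /= r4 r5.
case: ltnP => [lt_cp | le_pc].
  apply: (@runs_within_leq _ _ 3) => //; apply: dead => //.
  - by rewrite /centre leqNgt lt_cp.
  - by rewrite /regs /update /= r0 r1 r2 r3 r4 r5 r6 r7 r8 r9.
apply: (run_op (v := c + p)); first exact: erefl.
- by rewrite /update /= r4 r5.
- by lia.
apply: (run_lt (b := n < c + p)); first exact: erefl.
  by rewrite /update /= r0.
case: ltnP => [lt_ncp | le_cpn].
  apply: (@runs_within_leq _ _ 3) => //; apply: dead => //.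
  - by rewrite /centre (leqNgt (c + p)) lt_ncp andbF.
  - by rewrite /regs /update /= r0 r1 r2 r3 r4 r5 r6 r7 r8 r9.
have [mem_code _ mem_old] := tp.
have /mem_old [le_v old_c] : c <= c <= n by rewrite leqnn.
apply: (run_read (a := n + c)); try exact: erefl; try lia.
set reg1 := update _ 12 _.
have regs1 : regs p c reg1.
  by rewrite /regs /reg1 /update /= r0 r1 r2 r3 r4 r5 r6 r7 r8 r9.
have reg1_10 : reg1 10 = n + c by [].
have reg1_11 : reg1 11 = c + p by [].
have reg1_12 : reg1 12 = mem (n + c) by [].
(* The three outcomes of comparing the old cell with 1 are merged into one state, so the rest is
   executed symbolically only once. *)
apply: (@runs_within_trans _ _ 3 21 _ (fun st =>
    st = Running (if centre p.-1 c then 18 else 39) reg1 mem)).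
  have [r0' r1' r2' r3' r4' r5' r6' r7' r8' r9'] := regs1.
  apply: (run_lt (b := mem (n + c) < 1)); first exact: erefl.
    by rewrite reg1_12 r6'.
  case: ltnP => [v0 | v_gt0].
    by apply: runs_within0; move: old_c v0; case: (centre _ _) => //; case: (mem _).
  apply: (run_lt (b := 1 < mem (n + c))); first exact: erefl.
    by rewrite reg1_12 r6'.
  case: ltnP => [v_gt1 | v_le1].
    by apply: runs_within0; move: old_c v_gt1; case: (centre _ _) => // /eqP ->.
  apply: run_jump; first exact: erefl.
  have v1 : mem (n + c) = 1 by lia.
  by apply: runs_within0; move: old_c; rewrite v1 /=; case: (centre _ _).
move=> _ ->; move: reg1 regs1 reg1_10 reg1_11 {reg1_12 old_c le_v}.
clear reg r0 r1 r2 r3 r4 r5 r6 r7 r8 r9 => reg.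
move=> hreg; have [r0 r1 r2 r3 r4 r5 r6 r7 r8 r9] := hreg => r10 r11.
have centre_pc : centre p c = centre p.-1 c && (test (c - p) (c + p.-1) %| T).
  by rewrite -{1}(prednK p_gt0) centre_test ?prednK //; lia.
case: ifP => old_c; rewrite old_c /= in centre_pc; last first.
  by apply: (@runs_within_leq _ _ 3) => //; apply: dead; rewrite // centre_pc.
have [lt_a lt_b] : c - p < n /\ c + p.-1 < n by lia.
have lt_tB := test_ltB lt_a lt_b.
have lt_aB := code_ltB lt_a; have lt_bB := code_ltB lt_b.
(* Since M > 0, every value computed on the way to [test] is at most [test], hence within the
   bound. *)
have le_e : (code (c - p) * N + code (c + p.-1)).+1 <=
    (code (c - p) * N + code (c + p.-1)).+1 * M by rewrite leq_pmulr.
have lt_eMB : (code (c - p) * N + code (c + p.-1)).+1 * M < B by apply: ltnW.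
apply: (run_op (v := c - p)); first exact: erefl.
- by rewrite /= r4 r5.
- by lia.
apply: (run_op (v := c + p.-1)); first exact: erefl.
- by rewrite /update /= r11 r6; lia.
- by lia.
apply: (run_read (a := c - p)); try exact: erefl; rewrite ?mem_code //; try lia.
apply: (run_read (a := c + p.-1)); try exact: erefl; rewrite ?mem_code //; try lia.
apply: (run_op (v := code (c - p) * N)); first exact: erefl.
- by rewrite /update /= r9.
- by lia.
apply: (run_op (v := code (c - p) * N + code (c + p.-1))); first exact: erefl.
- by rewrite /update /=.
- by lia.
apply: (run_op (v := (code (c - p) * N + code (c + p.-1)).+1)); first exact: erefl.
- by rewrite /update /= r6 addn1.
- by lia.
apply: (run_op (v := (code (c - p) * N + code (c + p.-1)).+1 * M)); first exact: erefl.
- by rewrite /update /= r7.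
- by lia.
apply: (run_op (v := test (c - p) (c + p.-1))); first exact: erefl.
- by rewrite /update /= r6 addn1.
- by lia.
apply: (run_op (v := T %/ test (c - p) (c + p.-1))); first exact: erefl.
- by rewrite /update /= r8.
- by apply: leq_ltn_trans ltTB; apply: leq_div.
apply: (run_op (v := T %/ test (c - p) (c + p.-1) * test (c - p) (c + p.-1)));
  first exact: erefl.
- by rewrite /update /=.
- by apply: leq_ltn_trans ltTB; apply: leq_trunc_div.
(* Rounding [T] down to a multiple of the modulus gives less than [T] exactly when the modulus does
   not divide [T]. *)
apply: (run_lt (b := ~~ centre p c)); first exact: erefl.
  by rewrite /update /= r8 centre_pc dvdn_eq ltn_neqAle leq_trunc_div andbT.
case: (boolP (centre p c)) => cp /=; last first.
  by apply: (@runs_within_leq _ _ 3) => //; apply: dead.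
by apply: (@runs_within_leq _ _ 9) => //; apply: run_centre.
Qed.

(** Register 5 is arbitrary because it is reset before the next scan; p = 0 describes the state
    after initialisation. *)
Definition length_done p st := exists c reg mem,
  [/\ st = Running 5 reg mem, regs p c reg, tape p.+1 0 mem & unfound p.+1 0].

Lemma length_doneP p c reg mem : 0 < p -> n < c ->
  regs p c reg -> tape p c mem -> unfound p c ->
  length_done p (Running 5 reg mem).
Proof.
move=> p_gt0 lt_nc hreg [mem_code mem_cnt _] none; exists c, reg, mem; split=> //.
  split=> // j; rewrite andTb => le_jn; have cnt := mem_cnt j (leq_ltn_trans le_jn lt_nc).
  split; first by apply: leq_trans (counts_leq p_gt0 cnt) _.
  (* The instance m = 0 makes the cell positive, and m = 1 tells whether it exceeds 1. *)
  have := cnt 1; rewrite centre_runS andbT => <-.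
  by have := cnt 0; case: (mem _) => [|[|v]].
move=> p' j lt_sp' le_jn; rewrite andbF orbF ltnS leq_eqVlt => /orP [/eqP Ep | lt_p'p].
  by apply: none => //; rewrite Ep eqxx ltnn (leq_ltn_trans le_jn).
by apply: none => //; rewrite lt_p'p.
Qed.

Lemma run_length p c reg mem : 0 < p -> k * p <= n ->
  regs p c reg -> tape p c mem -> unfound p c ->
  runs (30 * (n.+1 - c)).+1 (Running 9 reg mem)
    (fun st => correct_answer st \/ length_done p st).
Proof.
move=> p_gt0 lekpn; move def_m: (n.+1 - c) => m.
elim: m => [|m IHm] in c def_m reg mem * => hreg tp none.
  apply: (run_lt (b := true)); first exact: erefl.
    by case: hreg => -> _ _ _ _ -> _ _ _ _; lia.
  by apply: runs_within0; right; apply: length_doneP hreg tp none; lia.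
rewrite mulnS -addnS; have le_cn : c <= n by lia.
apply: runs_within_trans (run_body p_gt0 lekpn le_cn hreg tp none) _ => st.
case=> [ans | [reg' [mem' [-> hreg' tp' none']]]].
  by apply: runs_within0; left.
by apply: IHm hreg' tp' none'; lia.
Qed.

Lemma run_lengths p st : p <= n %/ k -> length_done p st ->
  runs ((30 * n.+1 + 4) * (n %/ k - p) + 2) st correct_answer.
Proof.
move def_m: (n %/ k - p) => m.
elim: m => [|m IHm] in p def_m st * => le_p [c [reg [mem [-> hreg tp none]]]];
  have [r0 r1 r2 r3 r4 r5 r6 r7 r8 r9] := hreg.
  rewrite muln0 add0n; apply: (run_lt (b := false)); first exact: erefl.
    by rewrite r3 r4; lia.
  apply: run_answer; first exact: erefl.
  exists false => //; split=> // /(has_phi_powerP w hphi s k_gt1).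
  case=> p' [j [lt_sp' le_jn le_kp' run_j]].
  have small_p' : (p' < p.+1) || (p' == p.+1) && (j < 0).
    have : p' <= n %/ k by rewrite leq_divRL 1?mulnC //; lia.
    by lia.
  by have := none p' j lt_sp' le_jn small_p'; rewrite run_j.
have lt_p : p < n %/ k by lia.
have le_kp : k * p.+1 <= n by rewrite mulnC -leq_divRL //; lia.
(* Three instructions start a length, and the last loop test of its scan is the fourth. *)
rewrite mulnS -addnA {1}(_ : 30 * n.+1 + 4 = (30 * (n.+1 - 0)).+4); last by lia.
apply: runs_within_trans
  (_ : runs _ _ (fun st => correct_answer st \/ length_done p.+1 st)) _.
  apply: (run_lt (b := true)); first exact: erefl.
    by rewrite r3 r4.
  apply: (run_op (v := p.+1)); first exact: erefl.
  - by rewrite /= r4 r6 addn1.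
  - by have := leq_div n k; lia.
  apply: run_const; first exact: erefl.
  - by lia.
  apply: run_length => //.
  by rewrite /regs /update /= r0 r1 r2 r3 r6 r7 r8 r9.
move=> st' [ans | done]; first by apply: runs_within0.
by apply: (IHm p.+1) => //; lia.
Qed.

Lemma search_correct mem :
  (forall i, i < n -> mem i = code i) -> (forall j, mem (n + j) = 0) ->
  runs (7 + (30 * n.+1 + 4) * (n %/ k)) (Running 0 (nth 0 [:: n; k; s]) mem)
    correct_answer.
Proof.
move=> mem_code mem0.
apply: (@runs_within_leq _ _ ((30 * n.+1 + 4) * (n %/ k - 0) + 2).+4.+1).
  by rewrite subn0 addnC !addnS.
do 4! (apply: run_const; [exact: erefl | lia |]).
apply: (run_op (v := n %/ k)); first exact: erefl.
- by [].
- by have := leq_div n k; lia.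
apply: run_lengths => //; do 3 eexists; split=> //.
  split=> // j /= le_jn; by rewrite mem0 centre0 ?le_jn.
by move=> p' j lt_sp' _; lia.
Qed.

End Search.

Theorem theorem4 (A : finType) (phi : seq A -> seq A)
    (hphi : antimorphic_involution phi) :
  exists (P : program) (C d : nat), forall (k s : nat) (w : seq A),
    2 <= k ->
    exists (t : nat) (b : bool),
      [/\ answers_within P d k s w t b,
          b <-> has_phi_power phi k s w
        & t <= C * (size w ^ 2 %/ k).+1].
Proof.
have [f phi_cons] := antimorphic_involution_cons hphi.
pose R := fun a b : nat =>
  [exists x : A, (a == enum_rank x) && (b == enum_rank (f x))].
have [M [T [M_gt0 codeT]]] := rel_divisibility_code #|A| R.
(* With n = |w| and q = n / k, the time is 30 n q + 34 q + 7, and both n q and q are at most n ^ 2 /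
   k, so 30 + 34 + 7 suffices. The exponent [d] exceeds all program constants and test moduli, and d
   < (n + 2) ^ d. *)
exists (search #|A| M T), 71, (#|A| * #|A| * M + #|A| + M + T).+4.
move=> k s w k_gt1; set d := _.+4.
pose code i := nth 0 [seq nat_of_ord (enum_rank a) | a <- w] i.
have codeE x0 i : i < size w -> code i = enum_rank (nth x0 w i).
  by move=> lt_iw; rewrite /code (nth_map x0).
have code_lt i : i < size w -> code i < #|A|.
  case: w @code codeE => // x0 w' code codeE lt_iw; rewrite (codeE x0) //.
have lt_dB : d < (size w + 2) ^ d by rewrite ltn_expl // addn2.
have lt_nB : (size w).*2.+2 < (size w + 2) ^ d.
  apply: (@leq_trans ((size w + 2) ^ 2)); first by rewrite -mul2n; nia.
  by rewrite leq_pexp2l // addn2.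
have test_le i j : i < size w -> j < size w ->
    (code i * #|A| + code j).+1 * M <= #|A| * #|A| * M.
  move=> /code_lt lti /code_lt ltj; rewrite leq_mul2r; apply/orP; right.
  apply: (@leq_trans ((code i).+1 * #|A|)); first by rewrite mulSn addnC ltn_add2r.
  by rewrite leq_mul2r lti orbT.
have centre_test p c : p < c -> c + p < size w ->
    centre phi w p.+1 c = centre phi w p c &&
      (((code (c - p.+1) * #|A| + code (c + p)).+1 * M).+1 %| T).
  case Ew: w => [|x0 w'] //; rewrite -Ew => lt_pc lt_cpw.
  have lt_a : c - p.+1 < size w by lia.
  rewrite codeT ?code_lt // (centreS x0 phi_cons) // (codeE x0) // (codeE x0) //.
  congr (_ && _); apply/eqP/existsP => [-> | [x /andP [/eqP Ex /eqP Efx]]].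
    by exists (nth x0 w (c - p.+1)); rewrite !eqxx.
  by move/val_inj/enum_rank_inj: Efx => ->; move/val_inj/enum_rank_inj: Ex => ->.
have mem0 j : code (size w + j) = 0.
  by rewrite /code nth_default // size_map leq_addr.
have test_lt i j : i < size w -> j < size w ->
    ((code i * #|A| + code j).+1 * M).+1 < (size w + 2) ^ d.
  by move=> lti ltj; have := test_le i j lti ltj; rewrite /d in lt_dB *; lia.
have code_ltB i : i < size w -> code i < (size w + 2) ^ d.
  by move=> lti; have := code_lt i lti; rewrite /d in lt_dB *; lia.
have [t le_t [b haltb bP]] : runs_within ((size w + 2) ^ d) (search #|A| M T)
    (7 + (30 * (size w).+1 + 4) * (size w %/ k)) (init_state k s w)
    (correct_answer phi w k s).
  apply: (search_correct s hphi k_gt1 centre_test) => //; rewrite /d in lt_dB *; nia.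
exists t, b; split=> //; apply: leq_trans le_t _.
have le_nq : size w * (size w %/ k) <= size w ^ 2 %/ k.
  by rewrite leq_divRL ?(ltnW k_gt1) // -mulnA leq_mul2l leq_trunc_div orbT.
have le_q : size w %/ k <= size w * (size w %/ k).
  by case: (size w) => [|n]; [rewrite div0n | rewrite leq_pmull].
move: (size w %/ k) (size w ^ 2 %/ k) le_nq le_q => q X; nia.
Qed.
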